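(* There is an absolute constant $c_0>0$ such that the following holds. Let $d,n$ be positive integers and $\alpha,\delta\in[0,1]$. Every $2$-query $(\alpha,\delta)$-approximate LDC of size $n$ and dimension $d$ satisfies $n \geq 2^{c_0\,\alpha\delta\sqrt{d}}$ (i.e. $n\ge 2^{\Omega(\alpha\delta\sqrt d)}$).
   Context: For $\vec u\in\mathbb R^d$ nonzero, $\mathsf{weight}_i(\vec u)=|\langle \vec u,\vec e_i\rangle|/\|\vec u\|_2$, where $\vec e_i$ is the $i$-th standard basis vector. A $q$-matching in $[n]$ is a set of pairwise disjoint $q$-element subsets of $[n]=\{1,\dots,n\}$. A $q$-query $(\alpha,\delta)$-approximate LDC of size $n$ and dimension $d$ is a pair $(V,M)$ where $V=\{\vec v_1,\dots,\vec v_n\}$ is a multiset of vectors in $\mathbb R^d$ and $M=(M_1,\dots,M_d)$, each $M_i$ a $q$-matching in $[n]$, such that for every $i\in[d]$ and every $\{j_1,\dots,j_q\}\in M_i$ there is $\vec u\in\mathrm{span}\{\vec v_{j_1},\dots,\vec v_{j_q}\}$ with $\mathsf{weight}_i(\vec u)\ge\alpha$, and $|M_1|+\cdots+|M_d|\ge \delta d n$. *)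

(* Defs.v *)
From HB Require Import structures.
From mathcomp Require Import all_boot all_order all_algebra.
From mathcomp Require Import all_classical all_reals all_analysis.

Set Implicit Arguments.
Unset Strict Implicit.
Unset Printing Implicit Defensive.

Import Order.TTheory GRing.Theory Num.Theory.
Local Open Scope ring_scope.

Definition dotv (R : realType) (d : nat) (u v : 'rV[R]_d) : R :=
  \sum_(k < d) u 0 k * v 0 k.

(* The library norm on ['rV[R]_d] is the sup norm, hence this definition. *)
Definition norm2 (R : realType) (d : nat) (u : 'rV[R]_d) : R :=
  Num.sqrt (dotv u u).

(* Meaningful for [u != 0] only. *)
Definition weight (R : realType) (d : nat) (i : 'I_d) (u : 'rV[R]_d) : R :=
  `|dotv u (delta_mx 0 i)| / norm2 u.

Definition qmatching (q n : nat) (M : {set {set 'I_n}}) : Prop :=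
  finset.trivIset M /\ (forall S : {set 'I_n}, S \in M -> #|S| = q).

(* The multiset of vectors is the family [V] indexed by ['I_n].  The witness
   [u] must be nonzero, since weights are defined for nonzero vectors only. *)
Definition approx_LDC (R : realType) (q : nat) (alpha delta : R) (n d : nat)
    (V : 'I_n -> 'rV[R]_d) (M : 'I_d -> {set {set 'I_n}}) : Prop :=
  [/\ forall i : 'I_d, qmatching q (M i),
      forall (i : 'I_d) (S : {set 'I_n}), S \in M i ->
        exists u : 'rV[R]_d,
          [/\ u \in <<[seq V j | j in S]>>%VS, u != 0 & alpha <= weight i u]
    & delta * d%:R * n%:R <= \sum_(i < d) #|M i|%:R ].

(* Main.v *)
Require Import Defs.
From mathcomp Require Import all_boot all_order all_algebra.
From mathcomp Require Import all_classical all_reals all_analysis.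
From mathcomp Require Import ring lra.
(* The classical sets shadow names of the finite sets used throughout. *)
From mathcomp Require Import fintype finset.

(** Normalise the vectors and add their negatives. For unit vectors the span of
    a pair is spanned orthogonally by their sum and difference, so a decoding
    pair for [i] gives two differences of points whose [i]-th coordinates carry
    together at least the fraction [alpha / sqrt d] of the l1-norm. Now split
    the point set recursively by axis-parallel cuts. By averaging, one can
    choose each cut so that the total fraction carried by the separated edges is
    at most the number of separated edges in the direction of the cut; since
    these have degree at most two at every point, that number is at most twice
    the size of the smaller part. Summing over the recursion, the total fraction
    is O(n log n), while it is at least [(alpha / sqrt d) * delta * d * n]. *)

Set Implicit Arguments.
Unset Strict Implicit.
Unset Printing Implicit Defensive.

Import Order.TTheory GRing.Theory Num.Theory.
Local Open Scope ring_scope.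

Lemma exists_weighted_le (R : realDomainType) (I : finType) (w f g : I -> R) :
    (forall x, 0 <= w x) -> \sum_x w x != 0 ->
    \sum_x w x * f x <= \sum_x w x * g x ->
  exists2 x, 0 < w x & f x <= g x.
Proof.
move=> w_ge0 w_neq0 sum_le; apply: contrapT => no_le.
have lt_gf x : 0 < w x -> g x < f x.
  by move=> wx; rewrite ltNge; apply/negP => fg; apply: no_le; exists x.
have [x0 /= wx0] := psumr_neq0P (fun x _ => w_ge0 x) (elimN eqP w_neq0).
suff : \sum_x w x * g x < \sum_x w x * f x by rewrite ltNge sum_le.
rewrite (bigD1 x0) //= [ltRHS](bigD1 x0) //=.
rewrite ltr_leD ?ltr_pM2l ?lt_gf // ler_sum // => x _.
have := w_ge0 x; rewrite le_eqVlt => /predU1P [<-|wx]; first by rewrite !mul0r.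
by rewrite ler_pM2l // ltW ?lt_gf.
Qed.

Lemma sqr_sum_le (R : realFieldType) (I : finType) (x : I -> R) :
  (\sum_i x i) ^+ 2 <= #|I|%:R * \sum_i x i ^+ 2.
Proof.
have -> : #|I|%:R * \sum_i x i ^+ 2 = \sum_i \sum_j (x i ^+ 2 + x j ^+ 2) / 2.
  under [RHS]eq_bigr do rewrite -mulr_suml big_split sumr_const.
  rewrite -mulr_suml big_split /= sumr_const sumrMnl -mulr_natl.
  by field.
rewrite expr2 mulr_suml; apply: ler_sum => i _; rewrite mulr_sumr.
apply: ler_sum => j _; rewrite ler_pdivlMr // -subr_ge0.
by rewrite (_ : _ - _ = (x i - x j) ^+ 2) ?sqr_ge0 //; ring.
Qed.

Section Gaps.
Context {R : realDomainType} (s : seq R).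
Hypothesis sorted_s : sorted <=%O s.

Definition gap (k : nat) : R := s`_k.+1 - s`_k.

Let nth_le j k : (j <= k)%N -> (k < size s)%N -> s`_j <= s`_k.
Proof.
move=> jk ks; apply: (sorted_leq_nth le_trans le_refl) => //.
by rewrite inE (leq_ltn_trans jk).
Qed.

Lemma gap_ge0 k : (k < (size s).-1)%N -> 0 <= gap k.
Proof. by rewrite ltn_predRL => ks; rewrite subr_ge0 nth_le. Qed.

Lemma sum_gaps_below y : y \in s ->
  \sum_(k < (size s).-1) gap k *+ (s`_k < y)%R = y - s`_0.
Proof.
case/(nthP 0) => q qs <- {y}; set y := s`_q.
have s_gt0 : (0 < size s)%N by apply: leq_ltn_trans qs.
transitivity (\sum_(0 <= k < (size s).-1) (Num.min y s`_k.+1 - Num.min y s`_k)).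
  rewrite big_mkord; apply: eq_bigr => k _ /=.
  have ks : (k.+1 < size s)%N by rewrite -ltn_predRL.
  have [qk|kq] := leqP q k.
    rewrite !min_l ?nth_le ?(leqW qk) ?(ltnW ks) // subrr.
    by rewrite ltNge nth_le ?(ltnW ks).
  rewrite !min_r ?nth_le ?(ltnW kq) //; case: ltP => //.
  move=> yk; have kk : s`_k.+1 <= s`_k by apply: le_trans yk; apply: nth_le.
  by apply/eqP; rewrite eq_sym subr_eq0 eq_le kk nth_le ?(ltnW ks).
rewrite telescope_sumr // min_l ?min_r ?nth_le //.
  by rewrite -ltnS prednK.
by rewrite ltn_predL.
Qed.

Lemma sum_gaps_separating y z : y \in s -> z \in s ->
  \sum_(k < (size s).-1) gap k *+ ((y <= s`_k) != (z <= s`_k))%R = `|y - z|.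
Proof.
wlog yz : y z / y <= z.
  move=> wlog_le ys zs.
  have [/wlog_le/(_ ys zs) //|/ltW/wlog_le/(_ zs ys)] := leP y z.
  by rewrite distrC => <-; under eq_bigr do rewrite eq_sym.
move=> ys zs; rewrite distrC ger0_norm ?subr_ge0 //.
have -> : z - y = (z - s`_0) - (y - s`_0) by ring.
rewrite -!sum_gaps_below // -sumrB; apply: eq_bigr => k _.
rewrite !ltNge; have [yk|/lt_le_trans /(_ yz)] := leP y; last first.
  by rewrite ltNge => /negbTE ->; rewrite subrr.
by rewrite subr0; case: (z <= _).
Qed.

End Gaps.

Section DivideAndConquer.
Context {R : realType}.

Lemma min_ln2_le_entropy (x y : R) : 0 < x -> 0 < y ->
  Num.min x y * ln 2 <= (x + y) * ln (x + y) - x * ln x - y * ln y.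
Proof.
wlog xy : x y / x <= y.
  move=> wlog_le x0 y0; have /orP [/wlog_le|/wlog_le/(_ y0 x0)] := le_total x y.
    exact.
  by rewrite minC (addrC x y) addrAC.
move=> x0 y0; rewrite min_l //.
have ln_double : ln x + ln 2 <= ln (x + y).
  by rewrite -lnM ?posrE // ler_ln ?posrE ?mulr_gt0 ?addr_gt0 //; lra.
have ln_mono : ln y <= ln (x + y) by rewrite ler_ln ?posrE ?addr_gt0 //; lra.
have := ler_wpM2l (ltW x0) ln_double; have := ler_wpM2l (ltW y0) ln_mono.
by rewrite mulrDr mulrDl; lra.
Qed.

Lemma min_split_recursion_le (T : finType) (f : {set T} -> R) (c : R) :
    0 <= c ->
    (forall S, 0 < f S -> exists U : {set T}, [/\ U \proper S, U != set0 &
      f S <= f U + f (S :\: U) + c * Num.min #|U|%:R #|S :\: U|%:R]) ->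
  forall S, f S * ln 2 <= c * (#|S|%:R * ln #|S|%:R).
Proof.
move=> c_ge0 split S; have [m] := ubnP #|S|; elim: m S => // m IH S Sm.
have ln2_ge0 : 0 <= ln (2 : R) by rewrite ln_ge0 // ler1n.
have [fS|fS] := ltP 0 (f S); last first.
  apply: (@le_trans _ _ 0); first by rewrite mulr_le0_ge0.
  rewrite !mulr_ge0 //; have [->|S_gt0] := posnP #|S|; first by rewrite ln0.
  by rewrite ln_ge0 // ler1n.
have [U [US U0 fS_le]] := split S fS.
have cardS : (#|S| = #|U| + #|S :\: U|)%N.
  by rewrite -(cardsID U S) (setIidPr _) // proper_sub.
have U_gt0 : (0 < #|U|)%N by rewrite card_gt0.
have D_gt0 : (0 < #|S :\: U|)%N.
  by rewrite card_gt0 setD_eq0; move: US; rewrite properE => /andP [].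
have IHU : f U * ln 2 <= c * (#|U|%:R * ln #|U|%:R).
  by apply: IH; rewrite -ltnS (leq_trans _ Sm) // ltnS; exact: proper_card.
have IHD : f (S :\: U) * ln 2 <= c * (#|S :\: U|%:R * ln #|S :\: U|%:R).
  by apply: IH; rewrite -ltnS (leq_trans _ Sm) // ltnS cardS -add1n leq_add2r.
have := @min_ln2_le_entropy #|U|%:R #|S :\: U|%:R.
rewrite !ltr0n -natrD -cardS => /(_ U_gt0 D_gt0) /(ler_wpM2l c_ge0).
by move: (ler_wpM2r ln2_ge0 fS_le); rewrite !mulrDl !mulrBr; lra.
Qed.

End DivideAndConquer.

Section Crossing.
Context {T F : finType} (E : {set F}) (src tgt : F -> T).
Implicit Types (S U : {set T}) (D : {set F}).

Definition inner S : {set F} := [set e in E | (src e \in S) && (tgt e \in S)].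

Definition crossing S U : {set F} :=
  [set e in inner S | (src e \in U) != (tgt e \in U)].

Definition star D (a : T) : {set F} :=
  [set e in D | (src e == a) || (tgt e == a)].

Lemma sum_inner_split (V : nmodType) (f : F -> V) S U : U \subset S ->
  \sum_(e in inner S) f e = \sum_(e in inner U) f e +
    \sum_(e in inner (S :\: U)) f e + \sum_(e in crossing S U) f e.
Proof.
move=> /subsetP US; rewrite !(big_mkcond (fun e => e \in _)) -!big_split /=.
apply: eq_bigr => e _; rewrite !inE.
move/implyP: (US (src e)); move/implyP: (US (tgt e)).
case: (e \in E); case: (src e \in U); case: (tgt e \in U) => //=;
  case: (src e \in S); case: (tgt e \in S) => //= _ _;
  by rewrite ?addr0 ?add0r.
Qed.

Lemma card_crossing_le D k S U : (forall a, #|star D a| <= k)%N ->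
  (#|D :&: crossing S U| <= k * minn #|U| #|S :\: U|)%N.
Proof.
move=> deg_le.
have cover_le (W : {set T}) :
    (forall e, e \in crossing S U -> (src e \in W) || (tgt e \in W)) ->
    (#|D :&: crossing S U| <= k * #|W|)%N.
  move=> meetW; apply: (@leq_trans #|\bigcup_(a in W) star D a|).
    apply: subset_leq_card; apply/subsetP => e; rewrite inE.
    case/andP => eD /meetW /orP [] eW; apply/bigcupP.
      by exists (src e); rewrite // inE eD eqxx.
    by exists (tgt e); rewrite // inE eD eqxx orbT.
  rewrite mulnC -sum_nat_const.
  apply: leq_trans (leq_sum _ (fun a _ => deg_le a)).
  elim/big_rec2: _ => [|a B n _ Bn]; first by rewrite cards0.
  by rewrite (leq_trans (leq_card_setU _ _)) // leq_add2l.
rewrite minnMr leq_min !cover_le // => e;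
  rewrite !inE => /andP [/and3P [_ sS tS]];
  by rewrite ?sS ?tS; case: (src e \in U); case: (tgt e \in U).
Qed.

End Crossing.

Section Share.
Context {R : realFieldType} {d : nat}.
Implicit Types (v : 'rV[R]_d) (i : 'I_d).

Definition norm1 v : R := \sum_j `|v 0 j|.

(* Equal to [0] at [v = 0]. *)
Definition share i v : R := `|v 0 i| / norm1 v.

Lemma norm1_ge0 v : 0 <= norm1 v.
Proof. exact: sumr_ge0. Qed.

Lemma norm1Z (c : R) v : norm1 (c *: v) = `|c| * norm1 v.
Proof. by rewrite mulr_sumr; apply: eq_bigr => j _; rewrite mxE normrM. Qed.

Lemma share_ge0 i v : 0 <= share i v.
Proof. by rewrite divr_ge0 ?norm1_ge0. Qed.

Lemma share_norm1 i v : share i v * norm1 v = `|v 0 i|.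
Proof.
have [v0|v0] := eqVneq (norm1 v) 0; last by rewrite divfK.
by rewrite v0 mulr0 (psumr_eq0P _ v0).
Qed.

Lemma shareZ_le i (c : R) v : share i (c *: v) <= share i v.
Proof.
have [->|c0] := eqVneq c 0.
  by rewrite scale0r /share mxE normr0 mul0r share_ge0.
by rewrite /share norm1Z mxE normrM -mulf_div divff ?normr_eq0 // mul1r.
Qed.

End Share.

Section AxisCuts.
Context {R : realFieldType} {d : nat} {T F : finType}.
Context (X : T -> 'rV[R]_d) (E : {set F}) (src tgt : F -> T) (dir : F -> 'I_d).
Implicit Types (S : {set T}) (D : {set F}) (j : 'I_d).

Local Notation inner := (inner E src tgt).
Local Notation crossing := (crossing E src tgt).

Definition edge_vector e := X (src e) - X (tgt e).

Definition total_share D : R := \sum_(e in D) share (dir e) (edge_vector e).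

Definition directed j : {set F} := [set e in E | dir e == j].

Definition lower S j (t : R) : {set T} := [set a in S | X a 0 j <= t].

Definition levels S j : seq R := sort <=%O [seq X a 0 j | a in S].

Lemma size_levels S j : size (levels S j) = #|S|.
Proof. by rewrite size_sort size_image. Qed.

Lemma levelsP S j t :
  reflect (exists2 a, a \in S & t = X a 0 j) (t \in levels S j).
Proof. by rewrite mem_sort; apply: imageP. Qed.

Lemma sorted_levels S j : sorted <=%O (levels S j).
Proof. exact/sort_sorted/le_total. Qed.

Lemma sum_gaps_crossing S j e : e \in inner S ->
  \sum_(k < #|S|.-1) gap (levels S j) k *+
    (e \in crossing S (lower S j (levels S j)`_k)) = `|edge_vector e 0 j|.
Proof.
move=> eS; move: (eS); rewrite inE => /and3P [_ sS tS].
have /(sum_gaps_separating (sorted_levels S j)) : X (src e) 0 j \in levels S j.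
  by apply/levelsP; exists (src e).
have /[swap] /[apply] : X (tgt e) 0 j \in levels S j.
  by apply/levelsP; exists (tgt e).
rewrite size_levels !mxE => <-; apply: eq_bigr => k _.
by congr (_ *+ nat_of_bool _); rewrite [LHS]inE eS !inE sS tS.
Qed.

Local Notation cut_index S := ('I_d * 'I_(#|S|.-1))%type.

Definition cut_width S (x : cut_index S) : R := gap (levels S x.1) x.2.

Definition cut_edges S (x : cut_index S) : {set F} :=
  crossing S (lower S x.1 (levels S x.1)`_x.2).

Lemma sum_cut_width S (f : 'I_d -> F -> R) :
  \sum_(x : cut_index S) cut_width x * (\sum_(e in cut_edges x) f x.1 e) =
  \sum_(e in inner S) \sum_j f j e * `|edge_vector e 0 j|.
Proof.
rewrite exchange_big -(pair_bigA _ (fun j k => cut_width (j, k) *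
  \sum_(e in cut_edges (j, k)) f j e)) /=.
apply: eq_bigr => j _; rewrite /cut_width /cut_edges /=.
under [RHS]eq_bigr => e eS do rewrite -(sum_gaps_crossing _ eS) mulr_sumr.
rewrite exchange_big; apply: eq_bigr => k _ /=; rewrite mulr_sumr.
rewrite big_mkcond [RHS]big_mkcond; apply: eq_bigr => e _.
have [eS|eS] := boolP (e \in inner S); last by rewrite inE (negbTE eS).
by case: (e \in crossing _ _); rewrite ?mulr1n ?mulr0n ?mulr0 // mulrC.
Qed.

Lemma sum_cut_width_share S :
  \sum_(x : cut_index S) cut_width x * total_share (cut_edges x) =
  \sum_(e in inner S) `|edge_vector e 0 (dir e)|.
Proof.
rewrite (sum_cut_width S (fun _ e => share (dir e) (edge_vector e))).
by apply: eq_bigr => e _; rewrite -mulr_sumr share_norm1.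
Qed.

Lemma sum_cut_width_directed S :
  \sum_(x : cut_index S) cut_width x * #|directed x.1 :&: cut_edges x|%:R =
  \sum_(e in inner S) `|edge_vector e 0 (dir e)|.
Proof.
transitivity
  (\sum_(e in inner S) \sum_j (dir e == j)%:R * `|edge_vector e 0 j|).
  rewrite -sum_cut_width; apply: eq_bigr => x _; congr (_ * _).
  rewrite -sum1_card natr_sum big_mkcond [RHS]big_mkcond; apply: eq_bigr => e _.
  by rewrite !inE; case: (e \in E); case: eqP => //=; rewrite if_same.
apply: eq_bigr => e _; rewrite (bigD1 (dir e)) //= eqxx mul1r.
rewrite big1 ?addr0 // => j.
by rewrite eq_sym => /negbTE ->; rewrite mul0r.
Qed.

(* Average over all axis-parallel cuts, weighted by length: among the cuts
   crossed by an edge [e], a fraction [share (dir e)] is orthogonal to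
   [dir e], so both sides of the inequality have the same average. *)
Lemma exists_cut_share_le S : 0 < total_share (inner S) ->
  exists j t, let U := lower S j t in [/\ U \proper S, U != set0 &
    total_share (crossing S U) <= #|directed j :&: crossing S U|%:R].
Proof.
move=> share_gt0.
have sums_le :
    \sum_(x : cut_index S) cut_width x * total_share (cut_edges x) <=
    \sum_(x : cut_index S) cut_width x * #|directed x.1 :&: cut_edges x|%:R.
  by rewrite sum_cut_width_share sum_cut_width_directed.
have width_ge0 (x : cut_index S) : 0 <= cut_width x.
  by apply: gap_ge0; [exact: sorted_levels|rewrite size_levels].
have [|[j k] gap_gt0 share_le] := exists_weighted_le width_ge0 _ sums_le.
  apply: contraTneq share_gt0 => /psumr_eq0P width_eq0.
  have length_eq0 e : e \in inner S -> `|edge_vector e 0 (dir e)| = 0.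
    apply: (psumr_eq0P (fun e _ => normr_ge0 (edge_vector e 0 (dir e)))).
    by rewrite -sum_cut_width_share big1 // => x _; rewrite width_eq0 ?mul0r.
  rewrite /total_share big1 ?ltxx // => e eS.
  by rewrite /share length_eq0 ?mul0r.
have kS : (k.+1 < size (levels S j))%N by rewrite size_levels -ltn_predRL.
have /levelsP [a aS ka] := mem_nth 0 (ltnW kS).
have /levelsP [b bS kb] := mem_nth 0 kS.
exists j, (levels S j)`_k; split=> //.
  apply/properP; split; first by apply/subsetP => c; rewrite inE => /andP [].
  by exists b; rewrite // inE bS -kb -ltNge -subr_gt0.
by apply/set0Pn; exists a; rewrite inE aS -ka /=.
Qed.

End AxisCuts.

Lemma total_share_inner_le (R : realType) (d : nat) (T F : finType)
    (X : T -> 'rV[R]_d) (E : {set F}) (src tgt : F -> T) (dir : F -> 'I_d)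
    (k : nat) :
    (forall j a, #|star src tgt (directed E dir j) a| <= k)%N ->
  forall S, total_share X src tgt dir (inner E src tgt S) * ln 2 <=
    k%:R * (#|S|%:R * ln #|S|%:R).
Proof.
move=> deg_le; apply: min_split_recursion_le => // S.
move=> /exists_cut_share_le [j [t []]].
set U := lower X S j t => US U0 share_le; exists U; split=> //.
rewrite {1}/total_share (sum_inner_split _ _ _ _ (proper_sub US)) lerD2l.
apply: le_trans share_le _.
apply: le_trans (_ : (k * minn #|U| #|S :\: U|)%:R <= _).
  by rewrite ler_nat card_crossing_le.
by rewrite natrM natr_min.
Qed.

Section EuclideanGeometry.
Context {R : realType} {d : nat}.
Implicit Types (u v w s t : 'rV[R]_d) (i : 'I_d).

Lemma dotvC u v : dotv u v = dotv v u.
Proof. by apply: eq_bigr => k _; rewrite mulrC. Qed.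

Lemma dotvDl u v w : dotv (u + v) w = dotv u w + dotv v w.
Proof. by rewrite -big_split; apply: eq_bigr => k _; rewrite mxE mulrDl. Qed.

Lemma dotvZl (c : R) u v : dotv (c *: u) v = c * dotv u v.
Proof. by rewrite mulr_sumr; apply: eq_bigr => k _; rewrite mxE mulrA. Qed.

Lemma dotvDr u v w : dotv w (u + v) = dotv w u + dotv w v.
Proof. by rewrite dotvC dotvDl !(dotvC w). Qed.

Lemma dotvZr (c : R) u v : dotv u (c *: v) = c * dotv u v.
Proof. by rewrite dotvC dotvZl dotvC. Qed.

Lemma dotv_ge0 u : 0 <= dotv u u.
Proof. by apply: sumr_ge0 => k _; rewrite -expr2 sqr_ge0. Qed.

Lemma dotv_eq0 u : (dotv u u == 0) = (u == 0).
Proof.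
apply/eqP/eqP => [u0|->]; last by rewrite -(scale0r 0) dotvZl mul0r.
apply/rowP => k; apply/eqP; rewrite mxE -sqrf_eq0 expr2; apply/eqP.
by apply: (psumr_eq0P _ u0) => // l _; rewrite -expr2 sqr_ge0.
Qed.

Lemma dotv_delta u i : dotv u (delta_mx 0 i) = u 0 i.
Proof.
rewrite /dotv (bigD1 i) //= mxE !eqxx mulr1 big1 ?addr0 // => k /negbTE ki.
by rewrite mxE ki andbF mulr0.
Qed.

Lemma norm2_gt0 u : u != 0 -> 0 < norm2 u.
Proof.
by move=> u0; rewrite sqrtr_gt0 lt_neqAle eq_sym dotv_eq0 u0 dotv_ge0.
Qed.

Lemma norm2_le_orthogonalD s t : dotv s t = 0 -> norm2 s <= norm2 (s + t).
Proof.
move=> st; apply: ler_wsqrtr.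
by rewrite dotvDl !dotvDr (dotvC t s) st addr0 add0r lerDl dotv_ge0.
Qed.

Lemma norm1_le_norm2 v : norm1 v <= Num.sqrt d%:R * norm2 v.
Proof.
rewrite -[norm1 v]ger0_norm ?norm1_ge0 // -sqrtr_sqr -sqrtrM // ler_wsqrtr //.
have := sqr_sum_le (fun k => `|v 0 k|); rewrite card_ord.
by under [X in _ * X]eq_bigr do rewrite real_normK ?num_real // expr2.
Qed.

Lemma coord_le_share i v : `|v 0 i| <= Num.sqrt d%:R * share i v * norm2 v.
Proof.
rewrite -share_norm1 (mulrC (Num.sqrt _)) -[leRHS]mulrA.
by rewrite ler_wpM2l ?share_ge0 ?norm1_le_norm2.
Qed.

Lemma weight_orthogonalD_le i s t : dotv s t = 0 ->
  weight i (s + t) <= Num.sqrt d%:R * (share i s + share i t).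
Proof.
move=> st; have [st0|/norm2_gt0 st_gt0] := eqVneq (s + t) 0.
  rewrite /weight st0 dotv_delta mxE normr0 mul0r.
  by rewrite mulr_ge0 ?addr_ge0 ?share_ge0.
rewrite /weight ler_pdivrMr // dotv_delta mxE mulrDr mulrDl.
have coord_le v : norm2 v <= norm2 (s + t) ->
    `|v 0 i| <= Num.sqrt d%:R * share i v * norm2 (s + t).
  move=> /(ler_wpM2l _) v_le; apply: le_trans (coord_le_share i v) (v_le _ _).
  by rewrite mulr_ge0 ?share_ge0.
apply: le_trans (ler_normD _ _) _; apply: lerD; apply: coord_le.
  exact: norm2_le_orthogonalD.
by rewrite addrC norm2_le_orthogonalD // dotvC.
Qed.

Definition pair_share i v w : R := share i (v + w) + share i (v - w).

(* For vectors of equal length the sum and the difference are orthogonal, so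
   neither component of a combination is longer than the combination itself,
   however nearly parallel the two vectors are. *)
Lemma weight_combination_le i (x y : R) v w : dotv v v = dotv w w ->
  weight i (x *: v + y *: w) <= Num.sqrt d%:R * pair_share i v w.
Proof.
move=> vw; pose p := (x + y) / 2; pose q := (x - y) / 2.
have -> : x *: v + y *: w = p *: (v + w) + q *: (v - w).
  by apply/rowP => k; rewrite !mxE /p /q; field.
apply: le_trans (weight_orthogonalD_le _ _) _; last first.
  by rewrite ler_wpM2l // lerD ?shareZ_le.
rewrite dotvZl dotvZr -scaleN1r !dotvDl !dotvDr !dotvZr vw (dotvC w v).
by ring.
Qed.

Lemma exists_unit_generator v i :
  exists2 w, dotv w w = 1 & exists c : R, v = c *: w.
Proof.
have [->|v0] := eqVneq v 0.
  exists (delta_mx 0 i); first by rewrite dotv_delta mxE !eqxx.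
  by exists 0; rewrite scale0r.
have v_neq0 : norm2 v != 0 by rewrite gt_eqF ?norm2_gt0.
exists ((norm2 v)^-1 *: v); last first.
  by exists (norm2 v); rewrite scalerA divff ?scale1r.
rewrite dotvZl dotvZr -[dotv v v]sqr_sqrtr ?dotv_ge0 // -/(norm2 v).
by field.
Qed.

End EuclideanGeometry.

Lemma memv_span_set2 (K : fieldType) (L : vectType K) (T : finType) (V : T -> L)
    (a b : T) u : u \in <<[seq V j | j in [set a; b]]>>%VS ->
  exists x y : K, u = x *: V a + y *: V b.
Proof.
have span_sub : (<<[seq V j | j in [set a; b]]>> <= <[V a]> + <[V b]>)%VS.
  apply/span_subvP => _ /imageP [j + ->].
  rewrite !inE => /orP [] /eqP ->.
    exact: subvP (addvSl _ _) _ (memv_line _).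
  exact: subvP (addvSr _ _) _ (memv_line _).
move=> /(subvP span_sub) /memv_addP [_ /vlineP [x ->] [_ /vlineP [y ->] ->]].
by exists x, y.
Qed.

Lemma sum_matching_share_le (R : realType) (d : nat) (T : finType)
    (w : T -> 'rV[R]_d) (M : 'I_d -> {set {set T}})
    (ends : 'I_d -> {set T} -> T * T) :
    (forall i, trivIset (M i)) ->
    (forall i B, B \in M i -> ((ends i B).1 \in B) /\ ((ends i B).2 \in B)) ->
  (\sum_i \sum_(B in M i) pair_share i (w (ends i B).1) (w (ends i B).2)) *
    ln 2 <=
  2 * (2 * #|T|%:R * ln (2 * #|T|%:R)).
Proof.
move=> trivM endsM.
pose X (p : bool * T) := (-1) ^+ p.1 *: w p.2.
pose E := [set e : 'I_d * {set T} * bool | e.1.2 \in M e.1.1].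
pose src (e : 'I_d * {set T} * bool) := (false, (ends e.1.1 e.1.2).1).
pose tgt (e : 'I_d * {set T} * bool) := (e.2, (ends e.1.1 e.1.2).2).
pose dir (e : 'I_d * {set T} * bool) := e.1.1.
have deg_le j (p : bool * T) : (#|star src tgt (directed E dir j) p| <= 2)%N.
  rewrite -card_bool -cardsT.
  apply: leq_trans
    (leq_imset_card (fun c => (j, pblock (M j) p.2, c)) [set: bool]).
  apply/subset_leq_card/subsetP => -[[i B] c]; rewrite !inE /=.
  case/andP => /andP [BM /eqP ij]; rewrite -{}ij in BM * => incident.
  suff p2B : p.2 \in B.
    by apply/imsetP; exists c; rewrite ?inE // (def_pblock (trivM i) BM p2B).
  by have [? ?] := endsM _ _ BM; case/orP: incident => /eqP <-.
have both_signs (p : 'I_d * {set T}) :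
    pair_share p.1 (w (ends p.1 p.2).1) (w (ends p.1 p.2).2) =
    \sum_c share p.1 (edge_vector X src tgt (p, c)).
  rewrite big_bool /pair_share /edge_vector /X /= expr0 expr1.
  by rewrite !scale1r scaleN1r opprK.
have := total_share_inner_le X deg_le [set: bool * T].
rewrite cardsT card_prod card_bool natrM => upper; apply: etrans upper.
congr (_ * _ <= _); rewrite pair_big_dep; under eq_bigr do rewrite both_signs.
rewrite pair_big_dep; apply: eq_big => [e|[[i B] c]] //=.
by rewrite !inE !andbT.
Qed.

Lemma qmatching_card_le q n (M : {set {set 'I_n}}) :
  qmatching q M -> (#|M| * q <= n)%N.
Proof.
case=> trivM card_M; rewrite -sum_nat_const -(eq_bigr _ card_M).
have := leq_card_cover M; rewrite trivM => -[_ /eqP <-].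
by rewrite -[leqRHS]card_ord max_card.
Qed.

Lemma exists_endpoint_shares (R : realType) (alpha delta : R) (n d : nat)
    (V : 'I_n -> 'rV[R]_d) (M : 'I_d -> {set {set 'I_n}}) :
    (0 < d)%N -> (0 < n)%N -> approx_LDC 2 alpha delta V M ->
  exists (w : 'I_n -> 'rV[R]_d) (ends : 'I_d -> {set 'I_n} -> 'I_n * 'I_n),
    forall i B, B \in M i -> [/\ (ends i B).1 \in B, (ends i B).2 \in B &
      alpha <= Num.sqrt d%:R * pair_share i (w (ends i B).1) (w (ends i B).2)].
Proof.
move=> d_gt0 n_gt0 [matchM decode _].
have /choice [w wP] :
    forall a, exists w, dotv w w = 1 /\ exists c : R, V a = c *: w.
  move=> a; have [w w1 Vw] := exists_unit_generator (V a) (Ordinal d_gt0).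
  by exists w.
suff /choice [ends endsP] :
    forall x : 'I_d * {set 'I_n}, exists p : 'I_n * 'I_n, x.2 \in M x.1 ->
      [/\ p.1 \in x.2, p.2 \in x.2 &
        alpha <= Num.sqrt d%:R * pair_share x.1 (w p.1) (w p.2)].
  by exists w, (fun i B => ends (i, B)) => i B BM; apply: (endsP (i, B)).
move=> [i B] /=; have [BM|_] := boolP (B \in M i); last first.
  by exists (Ordinal n_gt0, Ordinal n_gt0).
have /eqP/cards2P [a [b [_ BE]]] := (matchM i).2 _ BM.
exists (a, b) => _; rewrite BE !inE !eqxx orbT; split=> //=.
have [u [+ _ /le_trans]] := decode _ _ BM.
rewrite BE => /memv_span_set2 [x [y ->]]; apply.
have [[wa [ca ->]] [wb [cb ->]]] := (wP a, wP b).
by rewrite !scalerA weight_combination_le // wa wb.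
Qed.

Lemma approx_LDC_delta_le0 (R : realType) (q : nat) (alpha delta : R)
    (n d : nat) (V : 'I_n -> 'rV[R]_d) (M : 'I_d -> {set {set 'I_n}}) :
    (0 < d)%N -> (0 < n < q)%N -> approx_LDC q alpha delta V M ->
  delta <= 0.
Proof.
move=> d_gt0 /andP [n_gt0 nq] [matchM _]; rewrite big1 => [|i _].
  by rewrite -mulrA pmulr_lle0 // mulr_gt0 ?ltr0n.
have := qmatching_card_le (matchM i); case: #|M i| => // m.
by rewrite mulSn leqNgt ltn_addr.
Qed.

Lemma approx_LDC_ln_size_ge (R : realType) (alpha delta : R) (n d : nat)
    (V : 'I_n -> 'rV[R]_d) (M : 'I_d -> {set {set 'I_n}}) :
    (0 < d)%N -> (1 < n)%N -> 0 <= alpha -> approx_LDC 2 alpha delta V M ->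
  alpha * delta * Num.sqrt d%:R * ln 2 <= 8 * ln n%:R.
Proof.
move=> d_gt0 n_gt1 alpha_ge0 ldc; have n_gt0 := ltnW n_gt1.
have [w [ends endsP]] := exists_endpoint_shares d_gt0 n_gt0 ldc.
have [matchM _ many] := ldc.
have := @sum_matching_share_le R d _ w M ends (fun i => (matchM i).1).
set total := \sum_i _ => upper.
have {}upper : total * ln 2 <= 2 * (2 * n%:R * ln (2 * n%:R)).
  by rewrite -(card_ord n) upper // => i B /endsP [].
have lower : alpha * (delta * d%:R * n%:R) <= Num.sqrt d%:R * total.
  apply: le_trans (ler_wpM2l alpha_ge0 many) _.
  rewrite !mulr_sumr; apply: ler_sum => i _.
  rewrite mulr_natr -sumr_const mulr_sumr; apply: ler_sum => B.
  by case/endsP.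
have n_pos : 0 < n%:R :> R by rewrite ltr0n.
have sqrt_pos : 0 < Num.sqrt d%:R :> R by rewrite sqrtr_gt0 ltr0n.
have ln2_ge0 : 0 <= ln 2 :> R by rewrite ln_ge0 // ler1n.
have ln_2n : ln (2 * n%:R) <= 2 * ln n%:R :> R.
  have : ln 2 <= ln n%:R :> R by rewrite ler_ln ?posrE ?ler_nat.
  by rewrite lnM ?posrE //; lra.
have total_ge : alpha * delta * Num.sqrt d%:R * n%:R <= total.
  rewrite -(ler_pM2l sqrt_pos); apply: le_trans lower.
  by rewrite -[in leRHS](sqr_sqrtr (ler0n R d)); lra.
rewrite -(ler_pM2l n_pos).
by have := ler_wpM2r ln2_ge0 total_ge; have := ler_wpM2l (ltW n_pos) ln_2n; lra.
Qed.

Theorem theorem1 (R : realType) :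
  exists c0 : R, 0 < c0 /\
    forall (d n : nat) (alpha delta : R),
      (0 < d)%N -> (0 < n)%N ->
      0 <= alpha <= 1 -> 0 <= delta <= 1 ->
      forall (V : 'I_n -> 'rV[R]_d) (M : 'I_d -> {set {set 'I_n}}),
        approx_LDC 2 alpha delta V M ->
        2 `^ (c0 * alpha * delta * Num.sqrt d%:R) <= n%:R.
Proof.
exists (1 / 8); split; first by rewrite divr_gt0.
move=> d n alpha delta d_gt0 n_gt0 /andP [alpha_ge0 _].
move=> /andP [delta_ge0 _] V M ldc.
have [n_le1|n_gt1] := leqP n 1.
  have delta_le0 : delta <= 0.
    by apply: approx_LDC_delta_le0 ldc; rewrite ?n_gt0.
  have -> : delta = 0 by apply/le_anti/andP.
  by rewrite mulr0 mul0r powRr0 ler1n.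
rewrite -ler_ln ?posrE ?powR_gt0 ?ltr0n // ln_powR.
by have := approx_LDC_ln_size_ge d_gt0 n_gt1 alpha_ge0 ldc; lra.
Qed.
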